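(* Let $r$ be a positive integer and let $V$ be a finite non-empty set such that $2r$ divides $|V|$. Then every function $F \in \mathcal{F}_r(V)$ satisfies: 1. (Non-negativity and boundedness) for every $S \subseteq V$, $F(S) \in [0,2]$; 2. (Unique minimizer) $F$ has a unique minimizer, and it is of the form $S^* = \bigcup_{i=1}^{\ell} R_i$, where $\ell = |V|/(2r)$, $V = A_1\cup\cdots\cup A_\ell$ is a partition with $|A_i| = 2r$ for all $i\in\{1,\dots,\ell\}$, and $R_i \subseteq A_i$ with $|R_i| = r$ for all $i\in\{1,\dots,\ell\}$; 3. (Submodularity) $F$ is submodular.
   Context: A function $f: 2^V \to \mathbb{R}$ on subsets of a finite set $V$ is submodular if $f(X)+f(Y) \ge f(X\cup Y) + f(X \cap Y)$ for all $X, Y \subseteq V$. $\subsetneq$ and $\supsetneq$ denote strict inclusion; $\mathbf{1}(\cdot)$ is the indicator. For $R\subseteq A$, the function $f_{A,R}: 2^A \to \mathbb{R}$ is $$f_{A,R}(S) := \begin{cases} 0 & \text{if } S = R,\\ 1 & \text{if } S \subsetneq R \text{ or } S \supsetneq R,\\ 2 & \text{otherwise.}\end{cases}$$ For $R \subseteq A\subseteq V$ and $B := V\setminus A$, writing $S_A := S\cap A$ and $S_B := S\cap B$, the function $\phi_{V,A,R}: 2^V\to\mathbb{R}$ is $$\phi_{V,A,R}(S) := \begin{cases} |S_B| & \text{if } S_A \subsetneq R,\\ -|S_B| & \text{if } S_A \supsetneq R,\\ 0 & \text{otherwise (in particular if } S_A = R).\end{cases}$$ For $g:2^B\to\mathbb{R}$,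 define $F^{2,g}_{V,A,R}: 2^V\to\mathbb{R}$ by $$F^{2,g}_{V,A,R}(S) := f_{A,R}(S_A) + \frac{1}{2|V|}\phi_{V,A,R}(S) + \frac{1}{8|V|}\mathbf{1}(S_A = R)\, g(S_B).$$ The family $\mathcal{F}_r(V)$ of functions $2^V\to\mathbb{R}$, for $|V|$ a positive multiple of $2r$, is defined recursively: if $|V| = 2r$, then $\mathcal{F}_r(V) := \{f_{V,R} : R\subseteq V, |R| = r\}$; if $|V| = 2rk$ with $k\ge 2$, then $$\mathcal{F}_r(V) := \{F^{2,g}_{V,A,R} : R\subseteq A\subseteq V,\ |R| = |A|/2 = r,\ g\in\mathcal{F}_r(V\setminus A)\}.$$ *)

(* Defs.v *)
From mathcomp Require Import all_boot all_order all_algebra.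
Set Implicit Arguments.
Unset Strict Implicit.
Unset Printing Implicit Defensive.
Import Order.TTheory GRing.Theory Num.Theory.
Local Open Scope ring_scope.

(** The ground sets [V], [A], [B], ... are finite sets over a finite type [T].
    A function [2^V -> K] is represented by a function [{set T} -> K] of which
    only the values on subsets of [V] are meaningful: every notion below
    depends only on these values. *)

Section SetFunctions.
Variables (K : realFieldType) (T : finType).
Implicit Types (V A R S X Y : {set T}) (F g : {set T} -> K) (r : nat).

Definition submodular V F : Prop :=
  forall X Y, X \subset V -> Y \subset V ->
    F X + F Y >= F (X :|: Y) + F (X :&: Y).

Definition minimizer V F S : Prop :=
  S \subset V /\ (forall X, X \subset V -> F S <= F X).

(** [A] only records the domain [2^A]: the formula does not mention it. *)
Definition f_fun A R S : K :=
  if S == R then 0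
  else if (S \proper R) || (R \proper S) then 1
  else 2.

Definition phi_fun V A R S : K :=
  let SA := S :&: A in
  let SB := S :&: (V :\: A) in
  if SA \proper R then #|SB|%:R
  else if R \proper SA then - #|SB|%:R
  else 0.

Definition F2_fun V A R g S : K :=
  let SA := S :&: A in
  let SB := S :&: (V :\: A) in
  f_fun A R SA
  + 1 / (2 * #|V|%:R) * phi_fun V A R S
  + 1 / (8 * #|V|%:R) * (SA == R)%:R * g SB.

(** [Ffamily r V F] means that [F], as a function on [2^V], is in [F_r(V)];
    membership is therefore up to equality on the subsets of [V]. *)
Inductive Ffamily r : {set T} -> ({set T} -> K) -> Prop :=
| Ffamily_base V R F :
    #|V| = (2 * r)%N ->
    R \subset V -> #|R| = r ->
    {in powerset V, F =1 f_fun V R} ->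
    Ffamily r V F
| Ffamily_step V (k : nat) A R g F :
    #|V| = (2 * r * k)%N -> (2 <= k)%N ->
    R \subset A -> A \subset V ->
    #|R| = r -> #|A| = (2 * r)%N ->
    Ffamily r (V :\: A) g ->
    {in powerset V, F =1 F2_fun V A R g} ->
    Ffamily r V F.

Definition block_union r V S : Prop :=
  let l := (#|V| %/ (2 * r))%N in
  exists A R : 'I_l -> {set T},
    [/\ V = \bigcup_(i < l) A i,
        (forall i j, i != j -> [disjoint A i & A j]),
        (forall i, #|A i| = (2 * r)%N),
        (forall i, R i \subset A i /\ #|R i| = r)
      & S = \bigcup_(i < l) R i].

End SetFunctions.

(* Main.v *)
Require Import Defs.
From mathcomp Require Import all_boot all_order all_algebra.
From mathcomp Require Import ring lra.
Import Order.TTheory GRing.Theory Num.Theory.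
Local Open Scope ring_scope.

Set Implicit Arguments.
Unset Strict Implicit.
Unset Printing Implicit Defensive.

(** Both clauses of the definition of [F_r(V)] have the shape [glue A B R w G]
    with [B] the complement of [A]: in the recursive case [w X = |X| / (2 |V|)]
    and [G = g / (8 |V|)], in the base case [B] is empty and [w = G = 0].
    Outside the sets with [S :&: A = R] the value of [glue] is at least [1/2],
    while [G] is at most [1/4]: the minimizer is [R] together with the minimizer
    of [G].  For submodularity, modularity of [w] and the gaps between the
    levels 0, 1, 2 suffice, except when exactly one of the two traces on [A]
    is [R] and the other is comparable to it; there a difference of values of
    [G], at most [1 / (4 |V|)], has to be absorbed by a difference of values of
    [w], which is at least [1 / (2 |V|)] unless both vanish. *)

Section Glue.
Variables (K : realFieldType) (T : finType).
Implicit Types (V A B R S X Y : {set T}) (F G w g : {set T} -> K).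

Definition glue A B R w G S : K :=
  if S :&: A \subset R then
    if R \subset S :&: A then G (S :&: B) else 1 + w (S :&: B)
  else if R \subset S :&: A then 1 - w (S :&: B) else 2.

(** [adm_exchU] and [adm_exchI] are the submodular inequality for [glue] when [X] has trace [R] on
    [A] and the trace of [Y] is strictly below, respectively strictly above, [R]. *)
Record admissible B w G : Prop := Admissible {
  adm_w0 : forall X, X \subset B -> 0 <= w X;
  adm_w_half : forall X, X \subset B -> w X <= 1 / 2;
  adm_w_mono : forall X Y, X \subset Y -> Y \subset B -> w X <= w Y;
  adm_w_mod : forall X Y, X \subset B -> Y \subset B ->
    w (X :|: Y) + w (X :&: Y) = w X + w Y;
  adm_G : forall X, X \subset B -> 0 <= G X <= 1 / 4;
  adm_G_submod : submodular B G;
  adm_exchU : forall X Y, X \subset B -> Y \subset B ->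
    G (X :|: Y) - G X <= w Y - w (X :&: Y);
  adm_exchI : forall X Y, X \subset B -> Y \subset B ->
    G (X :&: Y) - G X <= w (X :|: Y) - w Y }.

Lemma glue_bounds A B R w G S : admissible B w G -> 0 <= glue A B R w G S <= 2.
Proof.
move=> adm; have sB : S :&: B \subset B by apply: subsetIr.
have := adm_w0 adm sB; have := adm_w_half adm sB; have := adm_G adm sB.
by rewrite /glue; do 2 case: ifP => _; lra.
Qed.

Lemma glue_submodular V A B R w G : admissible B w G ->
  submodular V (glue A B R w G).
Proof.
move=> adm X Y _ _; rewrite /glue !setIUl.
rewrite !(setIIl X Y) !subUset (subsetI R (X :&: A)).
(* The goal now depends on the traces only through six inclusion tests; these four facts are the
   implications between them. *)
have := subset_trans (subsetIl (X :&: A) (Y :&: A)) (_ : _ \subset R).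
have := subset_trans (subsetIr (X :&: A) (Y :&: A)) (_ : _ \subset R).
have := subset_trans (_ : R \subset _) (subsetUl (X :&: A) (Y :&: A)).
have := subset_trans (_ : R \subset _) (subsetUr (X :&: A) (Y :&: A)).
have sX : X :&: B \subset B by apply: subsetIr.
have sY : Y :&: B \subset B by apply: subsetIr.
move: (X :&: A) (Y :&: A) (X :&: B) (Y :&: B) sX sY => a b x y sX sY.
have sU : x :|: y \subset B by rewrite subUset sX.
have sI : x :&: y \subset B by rewrite subIset ?sX.
have := (adm_exchU adm sX sY, adm_exchI adm sX sY).
have := (adm_exchU adm sY sX, adm_exchI adm sY sX).
have := (adm_w0 adm sI, adm_w_half adm sU, adm_w_mod adm sX sY).
have := (adm_w_mono adm (subsetUl x y) sU, adm_w_mono adm (subsetUr x y) sU).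
have := (adm_w_mono adm (subsetIl x y) sX, adm_w_mono adm (subsetIr x y) sY).
have := (adm_G adm sX, adm_G adm sY, adm_G adm sU, adm_G adm sI).
have := adm_G_submod adm sX sY.
rewrite (setUC y x) (setIC y x).
move: (w x) (w y) (w (x :|: y)) (w (x :&: y)) (G x) (G y) (G (x :|: y)) (G (x :&: y)).
move=> wx wy wU wI gx gy gU gI h1 [[[h2 h3] h4] h5] [h6 h7] [h8 h9].
move=> [[h10 h11] h12] [h13 h14] [h15 h16].
(* Each of the 64 truth assignments violates an implication or leaves a linear inequality in the
   eight values of [w] and [G]. *)
case: (a \subset R); case: (b \subset R); case: (R \subset a);
  case: (R \subset b); case: (R \subset a :|: b); case: (a :&: b \subset R) => /=;
  move=> // c1 c2 c3 c4; do ?[by have := c1 isT | by have := c2 isT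
    | by have := c3 isT | by have := c4 isT]; lra.
Qed.

Lemma glue_minimizer A B R w G S0 : R \subset A -> [disjoint A & B] ->
  admissible B w G -> unique (minimizer B G) S0 ->
  unique (minimizer (A :|: B) (glue A B R w G)) (R :|: S0).
Proof.
move=> sRA dAB adm [[sS0 minS0] uniqS0].
have dRB : R :&: B = set0.
  by apply/eqP; rewrite setI_eq0; apply: disjointWl dAB.
have dSA : S0 :&: A = set0.
  by apply/eqP; rewrite setI_eq0 disjoint_sym; apply: disjointWr dAB.
have IA : (R :|: S0) :&: A = R by rewrite setIUl dSA setU0; apply/setIidPl.
have IB : (R :|: S0) :&: B = S0 by rewrite setIUl dRB set0U; apply/setIidPl.
have glueS0 : glue A B R w G (R :|: S0) = G S0.
  by rewrite /glue IA IB subxx.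
have G_S0 := adm_G adm sS0.
split=> [|X [sX /(_ (R :|: S0))]].
  split=> [|X sX]; first by rewrite setUSS.
  have sB : X :&: B \subset B by apply: subsetIr.
  have := adm_w0 adm sB; have := adm_w_half adm sB; have := minS0 _ sB.
  by rewrite glueS0 /glue; do 2 case: ifP => _; lra.
rewrite glueS0 setUSS // => /(_ isT).
have sB : X :&: B \subset B by apply: subsetIr.
have := adm_w0 adm sB; have := adm_w_half adm sB.
rewrite /glue => w_half w_ge0 leX.
(* Any other trace would give a value of at least 1/2, whereas [G S0] is at most 1/4. *)
have /andP[XAR RXA] : (X :&: A \subset R) && (R \subset X :&: A).
  by move: leX; do 2 case: ifP => //= _; lra.
move: leX; rewrite XAR RXA => leX.
have XA : X :&: A = R by apply/eqP; rewrite eqEsubset XAR.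
have -> : S0 = X :&: B.
  by apply: uniqS0; split=> // Y sY; apply: le_trans leX (minS0 _ sY).
by rewrite -[X in X :|: _]XA -setIUr; apply/setIidPl.
Qed.

Lemma admissible0 : admissible set0 (fun=> 0) (fun=> 0).
Proof. by split=> * //; lra. Qed.

Lemma admissible_card V B g : B \subset V -> (0 < #|V|)%N ->
  (forall X, X \subset B -> 0 <= g X <= 2) -> submodular B g ->
  admissible B (fun X => 1 / (2 * #|V|%:R) * #|X|%:R)
               (fun X => 1 / (8 * #|V|%:R) * g X).
Proof.
move=> sBV V_gt0 g02 gsub.
have n_gt0 : 0 < #|V|%:R :> K by rewrite ltr0n.
set c := 1 / (2 * #|V|%:R).
have -> : 1 / (8 * #|V|%:R) = c / 4 :> K by rewrite /c; field; lra.
have c_gt0 : 0 < c by rewrite /c divr_gt0 // mulr_gt0.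
have cV : c * #|V|%:R = 1 / 2 by rewrite /c; field; lra.
have mono X Y : X \subset Y -> c * #|X|%:R <= c * #|Y|%:R.
  by move=> /subset_leq_card sXY; rewrite ler_pM2l // ler_nat.
have modular X Y :
    c * #|X :|: Y|%:R + c * #|X :&: Y|%:R = c * #|X|%:R + c * #|Y|%:R.
  by rewrite -!mulrDr -!natrD cardsUI.
have gap X Y : X \proper Y -> c <= c * #|Y|%:R - c * #|X|%:R.
  move=> /proper_card ltXY; rewrite -mulrBr ler_peMr ?(ltW c_gt0) //.
  by rewrite lerBrDl natr1 ler_nat.
split=> [X _|X sX|X Y sXY _|X Y _ _|X sX|X Y sX sY|X Y sX sY|X Y sX sY].
- by rewrite mulr_ge0 // ltW.
- by rewrite -cV mono // (subset_trans sX).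
- exact: mono.
- exact: modular.
(* From [cV], [c] is at most 1/2, so [c / 4 * g X <= c / 2 <= 1 / 4]. *)
- have V_ge1 : 1 <= #|V|%:R :> K by rewrite ler1n.
  have := g02 _ sX; nra.
- have := gsub _ _ sX sY; nra.
(* If [Y] lies in [X], both sides vanish; otherwise the left side is at most [c / 2] and, by [gap],
   the right side at least [c]. The last field is dual. *)
- case: (boolP (Y \subset X)) => [YX|nYX].
    by rewrite (setUidPl YX) (setIidPr YX) !subrr.
  have /gap : X :&: Y \proper Y by rewrite properE subsetIr subsetI subxx andbT.
  have := g02 _ sX; have := g02 (X :|: Y); rewrite subUset sX sY => /(_ isT).
  nra.
- case: (boolP (X \subset Y)) => [XY|nXY].
    by rewrite (setUidPr XY) (setIidPl XY) !subrr.
  have /gap : Y \proper X :|: Y by rewrite properE subsetUr subUset subxx andbT.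
  have := g02 _ sX; have := g02 (X :&: Y); rewrite subIset ?sX // => /(_ isT).
  nra.
Qed.

Lemma f_funE V R S : S \subset V ->
  f_fun K V R S = glue V set0 R (fun=> 0) (fun=> 0) S.
Proof.
move=> sSV; rewrite /f_fun /glue (setIidPl sSV) eqEsubset !properE.
by case: (S \subset R); case: (R \subset S) => /=; lra.
Qed.

Lemma F2_funE V A R g S :
  F2_fun V A R g S = glue A (V :\: A) R
    (fun X => 1 / (2 * #|V|%:R) * #|X|%:R)
    (fun X => 1 / (8 * #|V|%:R) * g X) S.
Proof.
rewrite /F2_fun /f_fun /phi_fun /glue eqEsubset !properE.
move: (1 / _) (1 / _) => c d.
by case: (_ \subset R); case: (R \subset _) => /=; ring.
Qed.

Lemma eq_submodular V F G : {in powerset V, F =1 G} ->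
  submodular V G -> submodular V F.
Proof.
move=> eqFG subG X Y sX sY.
rewrite !eqFG ?powersetE //; first exact: subG.
  by rewrite subIset ?sX.
by rewrite subUset sX.
Qed.

(** With [h] the identity this transfers minimizers along equality on subsets of [V]; with [h] a
    positive scaling it passes from [g] to [g / (8 |V|)]. *)
Lemma unique_minimizer_mono V F G S (h : K -> K) :
  {mono h : x y / x <= y} -> {in powerset V, F =1 h \o G} ->
  unique (minimizer V G) S -> unique (minimizer V F) S.
Proof.
move=> hmono eqFG.
have iff X : minimizer V F X <-> minimizer V G X.
  split=> [] [sX minX]; split=> // Y sY; have := minX Y sY;
    by rewrite !eqFG ?powersetE //= hmono.
by case=> /iff minS uniqS; split=> // X /iff /uniqS.
Qed.

End Glue.

Section Blocks.
Variables (T : finType) (r : nat).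
Implicit Types (V A R S : {set T}).

(** This is [block_union] with a free number of blocks, so that blocks can be added one at a time
    without division. *)
Definition blocks l V S : Prop :=
  exists A R : 'I_l -> {set T},
    [/\ V = \bigcup_(i < l) A i,
        (forall i j, i != j -> [disjoint A i & A j]),
        (forall i, #|A i| = (2 * r)%N),
        (forall i, R i \subset A i /\ #|R i| = r)
      & S = \bigcup_(i < l) R i].

Lemma blocks0 : blocks 0 set0 set0.
Proof. by exists (fun=> set0), (fun=> set0); split; rewrite ?big_ord0 // => -[]. Qed.

Lemma blocks_cons l V A R S : A \subset V -> #|A| = (2 * r)%N ->
  R \subset A -> #|R| = r -> blocks l (V :\: A) S -> blocks l.+1 V (R :|: S).
Proof.
move=> sAV cA sRA cR [A' [R' [defV disA cA' sR' defS]]].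
(* Index [ord0] carries the new block; the lifted indices carry the old ones. *)
exists (fun i => oapp A' A (unlift ord0 i)), (fun i => oapp R' R (unlift ord0 i)).
have dAA' j : [disjoint A & A' j].
  rewrite disjoint_sym disjoints_subset.
  have : A' j \subset V :\: A by rewrite defV bigcup_sup.
  by rewrite setDE subsetI => /andP[].
split.
- rewrite big_ord_recl unlift_none /= (eq_bigr A') => [|i _].
    by rewrite -defV -{1}(setIidPr sAV) setID.
  by rewrite liftK.
- move=> i j; case: (unliftP ord0 i) => [i'|] ->; case: (unliftP ord0 j) => [j'|] ->.
  + by rewrite (inj_eq lift_inj) => /disA.
  + by rewrite disjoint_sym /= dAA'.
  + by rewrite /= dAA'.
  + by rewrite eqxx.
- by move=> i; case: (unliftP ord0 i) => [i'|] _ //=.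
- by move=> i; case: (unliftP ord0 i) => [i'|] _ //=.
- rewrite big_ord_recl unlift_none /= (eq_bigr R') => [|i _].
    by rewrite -defS.
  by rewrite liftK.
Qed.

End Blocks.

Theorem lemma3p3 (K : realFieldType) (T : finType) (r : nat) (V : {set T})
    (hr : (0 < r)%N) (hV : V != set0) (hdvd : (2 * r %| #|V|)%N)
    (F : {set T} -> K) (hF : Ffamily r V F) :
  [/\ forall S : {set T}, S \subset V -> 0 <= F S <= 2,
      exists S : {set T}, unique (minimizer V F) S /\ block_union r V S
    & submodular V F].
Proof.
have r2_gt0 : (0 < 2 * r)%N by rewrite muln_gt0.
(* The three claims are proved together: the bounds and submodularity of [g] give admissibility, and
   its minimizer extends to that of [F]. *)
elim: hF {hV hdvd} => {V F} [V R F cV sRV cR eqF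
  | V k A R g F cV k_ge2 sRA sAV cR cA _ [g02 [S0 [minS0 blS0]] gsub] eqF].
  have eqF' : {in powerset V, F =1 glue V set0 R (fun=> 0) (fun=> 0)}.
    by move=> S SV; rewrite eqF // f_funE // -powersetE.
  have adm := @admissible0 K T; split.
  - by move=> S sS; rewrite eqF' ?powersetE //; apply: glue_bounds.
  (* The empty set is the minimizer over the empty complement, a union of zero blocks. *)
  - exists (R :|: set0); split.
      apply: (@unique_minimizer_mono _ _ _ _ _ _ id) eqF' _ => //.
      rewrite -[V in minimizer V]setU0; apply: glue_minimizer => //.
        by rewrite disjoint_sym disjoints_subset sub0set.
      split=> [|X [sX _]]; first by split.
      by apply/esym/eqP; rewrite -subset0.
    rewrite /block_union cV divnn r2_gt0.
    apply: (blocks_cons (A := V)) => //; rewrite setDv; exact: blocks0.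
  - by apply: eq_submodular eqF' _; apply: glue_submodular.
have V_gt0 : (0 < #|V|)%N by rewrite cV muln_gt0 r2_gt0 ltnW.
have adm := admissible_card (subsetDl V A) V_gt0 g02 gsub.
have eqF' S : S \in powerset V -> F S = _ := fun h => etrans (eqF S h) (F2_funE _ _ _ _ _).
split.
- by move=> S sS; rewrite eqF' ?powersetE //; apply: glue_bounds.
- exists (R :|: S0); split.
    apply: (@unique_minimizer_mono _ _ _ _ _ _ id) eqF' _ => //.
    rewrite -[V in minimizer V](setID V A) (setIidPr sAV).
    apply: glue_minimizer => //.
      by rewrite disjoint_sym disjoints_subset setDE subsetIr.
    apply: unique_minimizer_mono minS0 => [x y|X _]; last reflexivity.
    by rewrite ler_pM2l // divr_gt0 // mulr_gt0 // ltr0n.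
  rewrite /block_union.
  (* The complement of [A] has [2 * r * (k - 1)] elements, so removing [A] lowers the quotient from
     [k] to [k - 1]. *)
  have -> : (#|V| %/ (2 * r) = (#|V :\: A| %/ (2 * r)).+1)%N.
    rewrite cardsDS // cA cV -[X in (_ - X)%N]muln1 -mulnBr !mulKn //.
    by rewrite subn1 prednK // ltnW.
  exact: blocks_cons blS0.
- by apply: eq_submodular eqF' _; apply: glue_submodular.
Qed.
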